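(* Let $n\in\mathbb{N}$. The number of infinitely modern interval-posets of size $n$ is $\frac{1}{2n+1}\binom{3n}{n}$.
   Context: An interval-poset of size $n$ is a (reflexive) partial order $\lhd$ on $\{1,\dots,n\}$ such that for all $a<b<c$: $a\lhd c$ implies $b\lhd c$, and $c\lhd a$ implies $b\lhd a$. Rise: for a reflexive binary relation $\lhd$ on $P=\{1,\dots,n\}$, its rise $\mathrm{Ri}(P)$ is the set $\{1,\dots,n+1\}$ with the reflexive relation $\lhd_R$ defined by: for $x<y\le n$, $y\lhd_R x$ if and only if $y\lhd x$; for $1<x<y\le n+1$, $x\lhd_R y$ if and only if $x-1\lhd y-1$; no other relations between distinct elements. $\mathrm{Ri}^k(P)$ is the result of taking the rise $k$ times successively. An interval-poset $P$ is infinitely modern if $\mathrm{Ri}^k(P)$ is an interval-poset for every $k\ge 1$. *)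

(* Defs.v *)
From mathcomp Require Import all_boot all_order all_algebra.
From mathcomp Require Import boolp.

Set Implicit Arguments.
Unset Strict Implicit.
Unset Printing Implicit Defensive.

(* The ground set {1, ..., n} is encoded as 'I_n = {0, ..., n-1}, so the       *)
(* ordinal i stands for the element i + 1, and [R x y] reads "x <| y".         *)

Definition interval_poset (n : nat) (R : rel 'I_n) : Prop :=
  [/\ reflexive R, antisymmetric R, transitive R
    & forall a b c : 'I_n, a < b -> b < c ->
        (R a c -> R b c) /\ (R c a -> R b a)].

(* A decreasing relation (y <| x with x < y) is kept at the same labels,       *)
(* which are exactly the images of the inclusion [widen_ord (leqnSn n)]; an    *)
(* increasing one (x <| y with x < y) is shifted by one, [lift ord0 i] having  *)
(* value i + 1.                                                                *)
Definition rise (n : nat) (R : rel 'I_n) : rel 'I_n.+1 := fun u v =>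
  [|| u == v,
      [exists x : 'I_n, exists y : 'I_n,
        [&& x < y, u == widen_ord (leqnSn n) y, v == widen_ord (leqnSn n) x
          & R y x]]
    | [exists x : 'I_n, exists y : 'I_n,
        [&& x < y, u == lift ord0 x, v == lift ord0 y & R x y]]].

Fixpoint iter_rise (k n : nat) (R : rel 'I_n) : rel 'I_(k + n) :=
  match k return rel 'I_(k + n) with
  | 0 => R
  | k'.+1 => rise (@iter_rise k' n R)
  end.
Arguments iter_rise k {n} R _ _.

Definition infinitely_modern (n : nat) (R : rel 'I_n) : Prop :=
  interval_poset R /\ forall k : nat, 1 <= k -> interval_poset (iter_rise k R).

(* Binary relations on 'I_n are counted through their graphs, since the        *)
(* function type [rel 'I_n] is not a finType.                                  *)
Definition graph_rel (n : nat) (P : {set 'I_n * 'I_n}) : rel 'I_n :=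
  fun x y => (x, y) \in P.

(* Main.v *)
Require Import Defs.
From mathcomp Require Import all_boot all_order all_algebra.
From mathcomp Require Import boolp.
From mathcomp Require Import zify.

Set Implicit Arguments.
Unset Strict Implicit.
Unset Printing Implicit Defensive.

(** Every element x of an interval-poset has a right reach r_x, the largest k
    such that x + k is below x, and a left reach l_x, the largest k such that
    x - k is below x. The interval conditions say that the down-set of x is
    the whole interval from x - l_x to x + r_x, so the poset is determined by
    its reaches. Transitivity makes each of the two families of intervals
    nested, and antisymmetry forbids that x < d reach each other: the smaller
    of r_x and l_d must be less than d - x.

    Store r from the left and l from the right, as sequences padded by zeros:
    u_e is the left reach of the e-th element from the right end. Then the rise
    changes neither sequence; it only increases the ambient size
    ([rise_reach]). Imposing antisymmetry in all sizes N >= n amounts to the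
    single condition: if r_x and u_e are positive then x + e + min(r_x, u_e) + 1
    is less than n ([compatible], [infinitely_modern_reach]).

    Compatible pairs form a generating tree. The last element can be removed
    unless another element reaches it from the left, the first one unless
    another element reaches it from the right, and compatibility prevents both
    obstructions from occurring at once. Call parent the result of
    removing the last element if possible, and the first one otherwise.
    Conversely a new last element may choose as the far end of its left reach
    any point where no existing interval is cut, and a new first element
    likewise, except that only choices whose parent is the given pair are kept.
    The key point ([sum_children]) is that a pair with s children has children
    that themselves have 3, 4, ..., s + 2 children, once each. This is the
    generating tree of ternary trees, so the number of pairs of size n is the
    number [ballot n 1] of nodes at level n below a root with one child, and
    ballot numbers satisfy a Pascal recurrence that gives the closed form
    ([ballotE]). *)

(** * Ternary ballot numbers *)

(** Number of descendants after N generations of a node with s children, when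
    the children of such a node have 3, ..., s + 2 children. *)
Fixpoint ballot (N s : nat) : nat :=
  if N is N'.+1 then \sum_(j < s) ballot N' (j + 3) else 1.

(** From s to s + 1 the value increases by ballot N (s + 3), and Pascal's rule
    gives the same recurrence for the difference of the two binomials. At s = 0
    the two binomial terms cancel. *)
Lemma ballotE N s :
  ballot N.+1 s + 2 * 'C(3 * N + s + 2, N) = 'C(3 * N + s + 2, N.+1).
Proof.
elim: N s => [|N IHN] s.
  rewrite /= muln0 add0n bin0 bin1 (eq_bigr (fun=> 1)) // sum1_card card_ord.
  lia.
elim: s => [|s IHs].
  rewrite /= big_ord0.
  have := mul_bin_left (3 * N.+1 + 0 + 2) N.+1.
  have -> : 3 * N.+1 + 0 + 2 - N.+1 = N.+2 * 2 by lia.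
  by rewrite -mulnA => /eqP; rewrite eqn_pmul2l // => /eqP.
have step : ballot N.+2 s.+1 = ballot N.+2 s + ballot N.+1 (s + 3).
  exact: big_ord_recr.
have := IHN (s + 3).
have -> : 3 * N + (s + 3) + 2 = 3 * N.+1 + s + 2 by lia.
have -> : 3 * N.+1 + s.+1 + 2 = (3 * N.+1 + s + 2).+1 by lia.
by move: (3 * N.+1 + s + 2) IHs => M IHs; rewrite !(binS M) step; lia.
Qed.

Lemma ballot_ternary n : (2 * n + 1) * ballot n 1 = 'C(3 * n, n).
Proof.
case: n => [|n]; first by rewrite bin0.
have := ballotE n 1; have := mul_bin_left (3 * n.+1) n.
have -> : 3 * n + 1 + 2 = 3 * n.+1 by lia.
have -> : 3 * n.+1 - n = 2 * n.+1 + 1 by lia.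
move: (ballot _ _) 'C(_, n) 'C(_, n.+1) => w b c Hb Hc.
by nia.
Qed.

(** * Nested reach sequences and their cuts *)

(** The intervals [i, i + f i] lie within the first N integers and any two are
    nested or disjoint. The bound N is separate from the support of f because
    the same reaches are read in ambient sets of growing size. *)
Definition nested (N : nat) (f : nat -> nat) : Prop :=
  forall i, i < N -> i + f i < N /\
    forall j, i < j -> j <= i + f i -> j + f j <= i + f i.

Definition nested_seq (r : seq nat) : Prop := nested (size r) (nth 0 r).

(** No interval [i, i + r_i] contains both b - 1 and b: a new interval placed
    in front of r and covering exactly its first b positions keeps the family
    nested. *)
Definition cut (r : seq nat) (b : nat) : bool :=
  all (fun i => i + nth 0 r i < b) (iota 0 b).

Definition cuts (r : seq nat) : seq nat :=
  [seq b <- iota 0 (size r).+1 | cut r b].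

Lemma cutP r b : reflect (forall i, i < b -> i + nth 0 r i < b) (cut r b).
Proof.
apply: (iffP allP) => H i; last by rewrite mem_iota add0n => /H.
by move=> ib; apply: H; rewrite mem_iota.
Qed.

Lemma mem_cuts r b : (b \in cuts r) = (b <= size r) && cut r b.
Proof. by rewrite mem_filter mem_iota add0n ltnS /= andbC. Qed.

Lemma cuts_sorted r : sorted ltn (cuts r).
Proof. exact: sorted_filter ltn_trans _ _ (iota_ltn_sorted _ _). Qed.

Lemma cut_cons b r c : cut (b :: r) c.+1 = (b <= c) && cut r c.
Proof.
apply/cutP/andP => [H|[bc /cutP H] [|i] ic] /=; last 2 first.
- by rewrite add0n ltnS.
- by have /= := H i; lia.
split; first by have := H 0; rewrite /= add0n; lia.
by apply/cutP => i ic; have /= := H i.+1; lia.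
Qed.

Lemma cut_size r : nested_seq r -> cut r (size r).
Proof. by move=> H; apply/cutP => i /H []. Qed.

Lemma nth_rcons0 (r : seq nat) i : nth 0 (rcons r 0) i = nth 0 r i.
Proof.
by rewrite nth_rcons; case: ltngtP => // [/ltnW|->] *; rewrite nth_default.
Qed.

Lemma cut_rcons0 r b : b <= size r -> cut (rcons r 0) b = cut r b.
Proof.
move=> bs; apply: eq_in_all => i; rewrite mem_iota add0n /= => ib.
by rewrite nth_rcons (leq_trans ib bs).
Qed.

Lemma nested_cons b r :
  nested_seq (b :: r) <-> nested_seq r /\ b \in cuts r.
Proof.
rewrite mem_cuts; split=> [H|[H /andP[br /cutP bc]] [|i] /= ir].
- split=> [i ir|].
    have [/= H1 H2] := H i.+1 ir; split; first by lia.
    by move=> j ij jr; have /= := H2 j.+1; lia.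
  have [/= H1 H2] := H 0 isT; apply/andP; split; first by lia.
  by apply/cutP => i ib; have /= := H2 i.+1; lia.
- split; first by lia.
  by case=> [|j] //= _ jb; have := bc j; lia.
have [H1 H2] := H i ir; split; first by lia.
by case=> [|j] //= ij jr; have := H2 j; lia.
Qed.

Lemma nested_rcons0 r : nested_seq r -> nested_seq (rcons r 0).
Proof.
move=> H i; rewrite size_rcons ltnS leq_eqVlt => /predU1P[->|ir].
  by rewrite nth_rcons ltnn eqxx; split; lia.
have [H1 H2] := H i ir; rewrite nth_rcons ir; split; first by lia.
move=> j ij jr; have := H2 j ij jr.
by rewrite nth_rcons (_ : j < size r) //; lia.
Qed.

(** The last position can be dropped when no earlier interval contains it. *)
Lemma nested_rcons_cut r c : nested_seq (rcons r c) ->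
  cut (rcons r c) (size r) -> c = 0 /\ nested_seq r.
Proof.
move=> H /cutP Hc; split.
  have [] := H (size r); first by rewrite size_rcons.
  by rewrite size_rcons nth_rcons ltnn eqxx; lia.
move=> i ir; have [] := H i; first by rewrite size_rcons; lia.
have := Hc i ir; rewrite !nth_rcons ir => H1 _ H2; split=> // j ij jr.
by have := H2 j ij jr; rewrite nth_rcons (_ : j < size r) //; lia.
Qed.

Lemma cuts_cons b r :
  cuts (b :: r) = 0 :: [seq c.+1 | c <- cuts r & b <= c].
Proof.
have -> : cuts (b :: r) = 0 :: filter (cut (b :: r)) (iota (1 + 0) (size r).+1).
  by [].
rewrite iotaDl filter_map /cuts -filter_predI; congr (_ :: map _ _).
by apply: eq_filter => c /=; rewrite add1n cut_cons.
Qed.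

Lemma cuts_rcons0 r : nested_seq r ->
  cuts (rcons r 0) = rcons (cuts r) (size r).+1.
Proof.
move=> H; have Hc := cut_size (nested_rcons0 H).
rewrite /cuts size_rcons in Hc *; rewrite -[(size r).+2]addn1 iotaD cats1.
rewrite filter_rcons add0n Hc; congr (rcons _ _).
apply: eq_in_filter => b; rewrite mem_iota add0n ltnS => /= br.
exact: cut_rcons0.
Qed.

(** Counting the entries of v that are at least b ranks the entry b from the
    top, so the ranks of the entries above a threshold are 1, 2, 3, ... *)
Lemma sum_ranks (F : nat -> nat) k v : sorted ltn v ->
  \sum_(b <- v | k <= b) F (count (leq b) v)
    = \sum_(j < count (leq k) v) F j.+1.
Proof.
elim: v => [|a v IH]; first by rewrite !big_nil big_ord0.
move=> /= sv; have /allP lta := order_path_min ltn_trans sv.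
rewrite big_cons /= leqnn.
have -> : \sum_(b <- v | k <= b) F ((b <= a) + count (leq b) v)
    = \sum_(b <- v | k <= b) F (count (leq b) v).
  rewrite big_seq_cond [RHS]big_seq_cond; apply: eq_bigr => b /andP[/lta ab _].
  by rewrite leqNgt ab.
rewrite IH ?(path_sorted sv) //; case: leqP => // ka.
rewrite !add1n big_ord_recr /= addnC; congr (_ + F _.+1).
by apply: eq_in_count => b /lta /= ab; lia.
Qed.

(** * The generating tree *)

(** Reaches allowed for a new first element. If the last element could still be
    removed afterwards, the parent of the result would be another pair, hence
    the exclusion of the case where [size r] remains a cut. *)
Definition lefts (r : seq nat) : seq nat :=
  [seq b <- cuts r | ~~ cut (b :: r) (size r)].

(** The first component holds the left reaches, indexed from the right end: a
    new last element is a new head there, and a trailing zero in the second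
    component, which holds the right reaches. *)
Definition children (p : seq nat * seq nat) : seq (seq nat * seq nat) :=
  [seq (a :: p.1, rcons p.2 0) | a <- cuts p.1]
    ++ [seq (rcons p.1 0, b :: p.2) | b <- lefts p.2].

Definition parent (p : seq nat * seq nat) : seq nat * seq nat :=
  let n := (size p.2).-1 in
  if cut p.2 n then (behead p.1, take n p.2) else (take n p.1, behead p.2).

Definition tree_level (n : nat) : seq (seq nat * seq nat) :=
  iter n (fun s => flatten (map children s)) [:: ([::], [::])].

Definition compatible (n : nat) (f g : nat -> nat) : Prop :=
  forall x e, 0 < f x -> 0 < g e -> (x + e + minn (f x) (g e)).+1 < n.

Definition modern_pair (n : nat) (p : seq nat * seq nat) : Prop :=
  [/\ size p.1 = n, size p.2 = n, nested_seq p.1, nested_seq p.2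
    & compatible n (nth 0 p.2) (nth 0 p.1)].

(** Apart from the empty sequence, which has no left growth, either all cuts are
    allowed, when the last element is already reached by another one, or only
    the full reach, which makes it so. *)
Lemma leftsP r : nested_seq r ->
  exists k, lefts r = [seq b <- cuts r | k <= b].
Proof.
move=> H; rewrite /lefts; case Er: (size r) => [|m].
  exists 1; apply: eq_in_filter => b; rewrite mem_cuts Er leqn0.
  by case/andP=> /eqP-> _.
case Hc: (cut r m); [exists m.+1 | exists 0];
  by apply: eq_in_filter => b _; rewrite cut_cons Hc ?andbT ?andbF //= ltnNge.
Qed.

Lemma lefts_rcons0 r : nested_seq r -> lefts (rcons r 0) = [:: (size r).+1].
Proof.
move=> H; rewrite /lefts size_rcons cuts_rcons0 // filter_rcons.
rewrite cut_cons ltnn (@eq_in_filter _ _ pred0) ?filter_pred0 // => b.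
rewrite mem_cuts => /andP[br _].
by rewrite cut_cons br cut_rcons0 // cut_size.
Qed.

(** After a left growth the last element is reached by another one, and stays
    so whatever is added next on the left. *)
Lemma lefts_cons b r : b \in lefts r -> lefts (b :: r) = cuts (b :: r).
Proof.
rewrite mem_filter => /andP[/negbTE nc _]; apply/all_filterP/allP => c _.
by rewrite /= cut_cons nc andbF.
Qed.

Lemma size_children u r :
  size (children (u, r)) = size (cuts u) + size (lefts r).
Proof. by rewrite size_cat !size_map. Qed.

Lemma size_cuts_cons b r : size (cuts (b :: r)) = (count (leq b) (cuts r)).+1.
Proof.
have E s : size (0 :: map S s) = (size s).+1 by rewrite /= size_map.
by rewrite cuts_cons E size_filter.
Qed.

(** A right growth by a leaves as cuts 0 and the shifts of the cuts from a on,
    and exactly one left growth; so its number of children is 2 plus the rank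
    of a, which takes the values 3, ..., size (cuts u) + 2. A left growth by b
    adds one cut to u and its left growths are 0 and the shifts of the cuts of
    r from b on; so its number of children is size (cuts u) + 2 plus the rank
    of b, continuing the list of values without gap. *)
Lemma sum_children (F : nat -> nat) n p : modern_pair n p ->
  \sum_(q <- children p) F (size (children q))
    = \sum_(j < size (children p)) F (j + 3).
Proof.
case: p => u r Hp; have [Hu Hr] : nested_seq u /\ nested_seq r by case: Hp.
rewrite size_children big_split_ord big_cat !big_map.
rewrite [(u, r).1]/= [(u, r).2]/=; congr (_ + _).
  under eq_bigr do rewrite size_children size_cuts_cons (lefts_rcons0 Hr).
  rewrite (@sum_ranks (fun j => F (j.+1 + 1)) 0) ?cuts_sorted //.
  by rewrite count_predT; apply: eq_bigr => j _; congr F; rewrite /=; lia.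
have [k Ek] := leftsP Hr.
transitivity (\sum_(b <- lefts r)
    F (size (cuts u) + 2 + count (leq b) (cuts r))).
  apply: eq_big_seq => b Hb.
  rewrite size_children lefts_cons // size_cuts_cons (cuts_rcons0 Hu).
  by rewrite size_rcons; congr F; lia.
rewrite Ek big_filter (@sum_ranks (fun j => F (size (cuts u) + 2 + j))).
  rewrite size_filter; apply: eq_bigr => j _.
  by rewrite addn3 addn2 addnS !addSn.
exact: cuts_sorted.
Qed.

Lemma children_modern n p q :
  modern_pair n p -> q \in children p -> modern_pair n.+1 q.
Proof.
case: p => u r [/= su sr Hu Hr Hc].
have ub e : e + nth 0 u e < n \/ nth 0 u e = 0.
  case: (ltnP e (size u)) => eu; last by right; apply: nth_default.
  by left; rewrite -su; case: (Hu e).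
have rb x : x + nth 0 r x < n \/ nth 0 r x = 0.
  case: (ltnP x (size r)) => xr; last by right; apply: nth_default.
  by left; rewrite -sr; case: (Hr x).
rewrite mem_cat => /orP[] /mapP[a Ha ->]; split=> /=;
  rewrite ?size_rcons ?su ?sr //;
  try (by apply: nested_rcons0); try (by apply/nested_cons; split;
    rewrite // (mem_subseq (filter_subseq _ _) Ha)).
  move=> x [|e] /=; rewrite nth_rcons0; first by have := rb x; lia.
  by move=> fx ge; have := Hc x e fx ge; lia.
move=> [|x] e /=; rewrite nth_rcons0; first by have := ub e; lia.
by move=> fx ge; have := Hc x e fx ge; lia.
Qed.

Lemma parent_children n p q :
  modern_pair n p -> q \in children p -> parent q = p.
Proof.
case: p => u r [/= su sr Hu Hr Hc].
rewrite mem_cat => /orP[] /mapP[a Ha ->]; rewrite /parent /= ?size_rcons /=.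
  by rewrite cut_rcons0 // cut_size // -cats1 take_size_cat.
move: Ha; rewrite mem_filter => /andP[/negbTE-> _].
by rewrite -cats1 take_size_cat // su sr.
Qed.

Lemma modern_parent n p : modern_pair n.+1 p ->
  modern_pair n (parent p) /\ p \in children (parent p).
Proof.
case: p => u r [/= su sr Hu Hr Hc]; rewrite /parent /= sr /=.
case: ifPn => Hcut.
  case: u su Hu Hc => [|a u] //= [su] /nested_cons[Hu Ha] Hc.
  case/lastP: r sr Hr Hcut Hc => [|r c] //; rewrite size_rcons => -[sr] Hr.
  rewrite -sr => /(nested_rcons_cut Hr)[-> {}Hr] Hc.
  rewrite -cats1 take_size_cat //; split; last first.
    rewrite cats1 mem_cat; apply/orP; left.
    by apply/mapP; exists a.
  split=> //=; first by rewrite su sr.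
  move=> x e fx ge; have := Hc x e.+1 => /=.
  by rewrite nth_rcons0 => /(_ fx ge); lia.
case: r sr Hr Hcut Hc => [|b r] //= [sr] Hbr Hcut Hc.
have [Hr Hb] := (nested_cons b r).1 Hbr.
(* Some x reaches the last element. By compatibility no element then reaches
   left as far as the first one, so the first element can be removed. *)
have [x xn Hx] : exists2 x, x < n & x + nth 0 (b :: r) x = n.
  move: Hcut; rewrite -has_predC => /hasP[x]; rewrite mem_iota add0n /= => xn.
  rewrite -leqNgt => Hx; exists x => //.
  by have := (Hbr x); rewrite /= sr; lia.
have Hcu : cut u n.
  apply/cutP => e en; have := Hc x e; lia.
case/lastP: u su Hu Hcu Hc => [|u c] //; rewrite size_rcons => -[su] Hu.
rewrite -{1}su => /(nested_rcons_cut Hu)[-> {}Hu] Hc.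
rewrite -cats1 -su take_size_cat //; split; last first.
  rewrite mem_cat; apply/orP; right; rewrite cats1; apply/mapP; exists b => //.
  by rewrite mem_filter sr Hcut.
split=> //=; first by rewrite sr.
move=> y e fy ge; have := Hc y.+1 e fy => /=.
by rewrite nth_rcons0 => /(_ ge); lia.
Qed.

Lemma mem_tree_level n p : p \in tree_level n <-> modern_pair n p.
Proof.
elim: n p => [|n IH] p.
  rewrite inE; split=> [/eqP->|]; first by split=> // x e /=; rewrite nth_nil.
  by case: p => [[|? ?] [|? ?]] [].
rewrite /tree_level /= -/(tree_level n).
split=> [/flatten_mapP[q /IH Hq]|/modern_parent[/IH Hq Hp]].
  exact: children_modern.
by apply/flatten_mapP; exists (parent p).
Qed.

Lemma uniq_children n p : modern_pair n p -> uniq (children p).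
Proof.
case: p => u r Hp; have Hr : nested_seq r by case: Hp.
rewrite cat_uniq !map_inj_uniq; last 2 first.
- by move=> a b [].
- by move=> a b [].
rewrite !filter_uniq ?iota_uniq // andbT; apply/hasPn => q /mapP[b Hb ->].
apply/mapP => -[a Ha [_ E]]; move: Hb.
rewrite mem_filter E => /andP[] /negP; case.
by rewrite cut_rcons0 // cut_size.
Qed.

Lemma uniq_tree_level n : uniq (tree_level n).
Proof.
elim: n => [|n IH] //; rewrite /tree_level /= -/(tree_level n).
have : {in tree_level n, forall p, modern_pair n p} by move=> p /mem_tree_level.
elim: (tree_level n) IH => // p s IHs; rewrite cons_uniq => /andP[ps us] Hs.
have Hp : modern_pair n p by apply: Hs; rewrite mem_head.
have Hs' : {in s, forall q, modern_pair n q}.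
  by move=> q qs; apply: Hs; rewrite inE qs orbT.
change (uniq (children p ++ flatten (map children s))).
rewrite cat_uniq (uniq_children Hp) IHs // andbT; apply/hasPn => q.
case/flatten_mapP=> p' p's qp'; apply/negP => /= qp.
move: ps; rewrite -(parent_children Hp qp).
by rewrite (parent_children (Hs' _ p's) qp') p's.
Qed.

Lemma size_tree_level n : size (tree_level n) = ballot n 1.
Proof.
pose grow (s : seq (seq nat * seq nat)) := flatten (map children s).
suff H N m s : {in s, forall p, modern_pair m p} ->
    size (iter N grow s) = \sum_(p <- s) ballot N (size (children p)).
  rewrite (H _ 0) ?big_seq1 //.
  by move=> p; rewrite inE => /eqP->; apply/mem_tree_level.
elim: N m s => [|N IH] m s Hs; first by rewrite sum1_size.
rewrite iterSr (IH m.+1) => [|q /flatten_mapP[p ps]]; last first.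
  by apply: children_modern; apply: Hs.
rewrite big_flatten big_map; apply: eq_big_seq => p /Hs Hp.
exact: sum_children Hp.
Qed.

(** * From interval-posets to pairs of reach sequences *)

(** Right reaches are counted from the left end and left reaches from the right
    end, so that increasing N moves the elements with a left reach to the right
    and leaves those with a right reach in place. *)
Definition reach_rel (N : nat) (u r : seq nat) : rel 'I_N := fun a b =>
  [|| a == b, b < a <= b + nth 0 r b | a < b <= a + nth 0 u (N - b.+1)].

Lemma nested_widen N s : size s <= N -> nested_seq s -> nested N (nth 0 s).
Proof.
move=> sN H i iN; case: (ltnP i (size s)) => [/H[H1 H2]|si].
  by split; [lia | exact: H2].
by rewrite nth_default //; split; lia.
Qed.

(** Nestedness of each family gives transitivity along steps in the same
    direction; for steps in opposite directions, the condition on pairs confines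
    the smallest of the three in the order between the two others, hence to the
    interval below the greatest. The necessity comes from antisymmetry. *)
Lemma interval_poset_reach N u r : nested N (nth 0 u) -> nested N (nth 0 r) ->
  interval_poset (@reach_rel N u r) <->
  forall x e, (x + e).+1 < N -> (x + e + minn (nth 0 r x) (nth 0 u e)).+1 < N.
Proof.
move=> Hu Hr; split=> [[_ asym _ _] x e xe|Hc].
  rewrite ltnNge; apply/negP => big.
  have xN : x < N by lia.
  have eN : N - e.+1 < N by lia.
  have eE : N - (N - e.+1).+1 = e by lia.
  suff /(congr1 val) /= E : Ordinal xN = Ordinal eN by lia.
  by apply: asym; rewrite /reach_rel -!val_eqE /= eE; lia.
have Hx (x b : 'I_N) : x < b -> x + minn (nth 0 r x) (nth 0 u (N - b.+1)) < b.
  move=> xb; have := Hc x (N - b.+1); have := ltn_ord b; lia.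
split.
- by move=> a; rewrite /reach_rel eqxx.
- move=> a b; rewrite /reach_rel -!val_eqE /= => H; apply: val_inj => /=.
  have := Hx a b; have := Hx b a; lia.
- move=> b a c; have [->//|nab] := eqVneq a b; have [<-//|nbc] := eqVneq b c.
  move: nab nbc; rewrite /reach_rel -!val_eqE /= => nab nbc ab bc.
  have [_ H1] := Hr c (ltn_ord c); have := H1 b.
  have [_ H2] := Hu (N - c.+1) ltac:(have := ltn_ord c; lia).
  have := H2 (N - b.+1); have := Hx c b; have := Hx b c.
  have := ltn_ord a; have := ltn_ord b; have := ltn_ord c.
  by move: nab nbc ab bc; clear; lia.
move=> a b c ab bc; rewrite /reach_rel -!val_eqE /=; split; lia.
Qed.

(** The decreasing relations keep their labels, hence their distance to the left
    end; the increasing ones are shifted by one, as is the right end. *)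
Lemma rise_reach n u r : nested n (nth 0 u) -> nested n (nth 0 r) ->
  size u <= n -> size r <= n ->
  rise (@reach_rel n u r) = @reach_rel n.+1 u r.
Proof.
move=> Hu Hr su sr; apply/funext => a; apply/funext => b.
rewrite /rise {3}/reach_rel; congr (_ || _).
apply/orP/orP => -[].
- case/existsP=> x /existsP[y] /and4P[xy /eqP-> /eqP->].
  by rewrite /reach_rel -!val_eqE /= => H; left; lia.
- case/existsP=> x /existsP[y] /and4P[xy /eqP-> /eqP->].
  rewrite /reach_rel -!val_eqE /= /bump /= subSS !add1n => H; right; lia.
- move=> /andP[ba ab]; left.
  have bn : b < n by have := ltn_ord a; lia.
  have [an _] := Hr b bn.
  have {}an : a < n by lia.
  apply/existsP; exists (Ordinal bn); apply/existsP; exists (Ordinal an).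
  by rewrite /reach_rel -!val_eqE /=; lia.
move=> /andP[ab ba]; right.
have bn : n - b < n by have := ltn_ord b; lia.
have [b0 _] := Hu _ bn; rewrite subSS in ba.
have an' : a.-1 < n by have := ltn_ord b; lia.
have bn' : b.-1 < n by have := ltn_ord b; lia.
apply/existsP; exists (Ordinal an'); apply/existsP; exists (Ordinal bn').
rewrite /reach_rel -!val_eqE /= /bump /= (_ : n - b.-1.+1 = n - b); last by lia.
by have := ltn_ord b; lia.
Qed.

Lemma iter_rise_reach k n u r : nested_seq u -> nested_seq r ->
  size u = n -> size r = n ->
  iter_rise k (@reach_rel n u r) = @reach_rel (k + n) u r.
Proof.
move=> Hu Hr su sr; elim: k => //= k ->.
by apply: rise_reach; rewrite ?su ?sr ?leq_addl //; apply: nested_widen;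
  rewrite ?su ?sr ?leq_addl.
Qed.

(** Reading u from the right end of a larger set moves the element of index e
    away from x without changing the reaches. If both are positive and the
    condition fails, the ambient size (x + e + minn r_x u_e).+1 places the two
    elements exactly at the distance where they reach each other. *)
Lemma infinitely_modern_reach n u r : nested_seq u -> nested_seq r ->
  size u = n -> size r = n ->
  infinitely_modern (@reach_rel n u r) <-> compatible n (nth 0 r) (nth 0 u).
Proof.
move=> Hu Hr su sr.
have HN k : interval_poset (iter_rise k (@reach_rel n u r)) <->
    forall x e, (x + e).+1 < k + n ->
      (x + e + minn (nth 0 r x) (nth 0 u e)).+1 < k + n.
  rewrite iter_rise_reach //; apply: interval_poset_reach;
    by apply: nested_widen; rewrite ?su ?sr ?leq_addl.
split=> [[H0 Hk] x e fx ge|Hc].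
  have {Hk}H k : interval_poset (iter_rise k (@reach_rel n u r)).
    by case: k => [|k] //; apply: Hk.
  rewrite ltnNge; apply/negP => big.
  have := (HN ((x + e + minn (nth 0 r x) (nth 0 u e)).+1 - n)).1 (H _) x e.
  by rewrite subnK //; lia.
suff H k : interval_poset (iter_rise k (@reach_rel n u r)).
  by split; [exact: (H 0) | move=> k _; exact: H].
by apply/HN => x e xe; have := Hc x e; lia.
Qed.

(** The interval conditions make each down-set an interval, so the farthest
    elements below x on both sides determine it. *)
Lemma reach_of_interval_poset n (R : rel 'I_n) : interval_poset R ->
  exists u r, [/\ nested_seq u, nested_seq r, size u = n, size r = n
    & R = @reach_rel n u r].
Proof.
case: n R => [|n] R.
  by exists [::], [::]; split=> //; apply/funext => -[].
case=> Rxx Ranti Rtr Rint.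
pose right_reach (x : 'I_n.+1) := \max_(y < n.+1 | R y x) (y - x).
pose left_reach (d : 'I_n.+1) := \max_(x < n.+1 | R x d) (d - x).
have rightP (x y : 'I_n.+1) : x < y -> R y x = (y <= x + right_reach x).
  move=> xy; apply/idP/idP => [Ryx|yx].
    have := @leq_bigmax_cond _ (fun y => R y x) (fun y => y - x) y Ryx.
    by rewrite -/(right_reach x); lia.
  have [|z Rz Ez] :=
      @eq_bigmax_cond _ (fun y => R y x) (fun y : 'I_n.+1 => y - x).
    by apply/card_gt0P; exists x; apply: Rxx.
  rewrite -/(right_reach x) in Ez.
  have [yz|zy|/val_inj->//] := ltngtP y z; last by lia.
  by have [_] := Rint x y z xy yz; apply.
have leftP (d x : 'I_n.+1) : x < d -> R x d = (d <= x + left_reach d).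
  move=> xd; apply/idP/idP => [Rxd|dx].
    have := @leq_bigmax_cond _ (fun x => R x d) (fun x => d - x) x Rxd.
    by rewrite -/(left_reach d); lia.
  have [|z Rz Ez] :=
      @eq_bigmax_cond _ (fun x => R x d) (fun x : 'I_n.+1 => d - x).
    by apply/card_gt0P; exists d; apply: Rxx.
  rewrite -/(left_reach d) in Ez.
  have [xz|zx|/val_inj->//] := ltngtP x z; first by lia.
  by have [+ _] := Rint z x d zx xd; apply.
have right_bound (x : 'I_n.+1) : x + right_reach x < n.+1.
  suff : right_reach x <= n - x by have := ltn_ord x; lia.
  by apply/bigmax_leqP => y _; have := ltn_ord y; lia.
have left_bound (d : 'I_n.+1) : left_reach d <= d.
  by apply/bigmax_leqP => y _; lia.
have nthr (f : nat -> nat) i :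
    nth 0 (mkseq f n.+1) i = if i < n.+1 then f i else 0.
  by case: ltnP => ni; [rewrite nth_mkseq | rewrite nth_default ?size_mkseq].
exists (mkseq (fun e => left_reach (inord (n - e))) n.+1),
  (mkseq (fun x => right_reach (inord x)) n.+1).
split; rewrite ?size_mkseq //.
- move=> e; rewrite size_mkseq nthr => en; rewrite en.
  have de : (inord (n - e) : 'I_n.+1) = n - e :> nat by rewrite inordK //; lia.
  split; first by have := left_bound (inord (n - e)); lia.
  move=> j ej je; rewrite nthr; have := left_bound (inord (n - e)) => eb.
  have jn : j < n.+1 by lia.
  have dj : (inord (n - j) : 'I_n.+1) = n - j :> nat by rewrite inordK //; lia.
  (* The farthest element below n - j is also below n - e, by transitivity. *)
  rewrite jn; have [j0|j0] := posnP (left_reach (inord (n - j))); first by lia.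
  have zn : n - j - left_reach (inord (n - j)) < n.+1 by lia.
  have jb := left_bound (inord (n - j)).
  have : R (Ordinal zn) (inord (n - e)).
    apply: (@Rtr (inord (n - j))).
      by rewrite leftP ?dj /=; lia.
    by rewrite leftP ?dj ?de /=; lia.
  by rewrite leftP de /=; lia.
- move=> x; rewrite size_mkseq nthr => xn; rewrite xn.
  have dx : (inord x : 'I_n.+1) = x :> nat by rewrite inordK.
  split; first by have := right_bound (inord x); lia.
  move=> j xj jx; rewrite nthr; have := right_bound (inord x) => eb.
  have jn : j < n.+1 by lia.
  have dj : (inord j : 'I_n.+1) = j :> nat by rewrite inordK.
  rewrite jn; have [j0|j0] := posnP (right_reach (inord j)); first by lia.
  have jb := right_bound (inord j).
  have zn : j + right_reach (inord j) < n.+1 by lia.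
  have : R (Ordinal zn) (inord x).
    apply: (@Rtr (inord j)).
      by rewrite rightP ?dj /=; lia.
    by rewrite rightP ?dj ?dx /=; lia.
  by rewrite rightP dx /=; lia.
apply/funext => a; apply/funext => b; rewrite /reach_rel -val_eqE /= !nthr.
rewrite ltn_ord inord_val.
have an := ltn_ord a; have bn := ltn_ord b.
have -> : n.+1 - b.+1 < n.+1 by lia.
have -> : inord (n - (n.+1 - b.+1)) = b.
  by apply: val_inj; rewrite /= inordK; lia.
have [ab|ba|/val_inj->] := ltngtP a b; last by rewrite Rxx.
  by rewrite (leftP _ _ ab); lia.
by rewrite (rightP _ _ ba); lia.
Qed.

Lemma reach_rel_inj n u r u' r' :
  nested_seq u -> nested_seq r -> nested_seq u' -> nested_seq r' ->
  size u = n -> size r = n -> size u' = n -> size r' = n ->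
  @reach_rel n u r = @reach_rel n u' r' -> u = u' /\ r = r'.
Proof.
wlog suff : u r u' r' / nested_seq u -> nested_seq r ->
  nested_seq u' -> nested_seq r' ->
  size u = n -> size r = n -> size u' = n -> size r' = n ->
  @reach_rel n u r = @reach_rel n u' r' ->
  forall i, i < n -> nth 0 u i <= nth 0 u' i /\ nth 0 r i <= nth 0 r' i.
  move=> H Hu Hr Hu' Hr' su sr su' sr' E.
  have H1 := H u r u' r' Hu Hr Hu' Hr' su sr su' sr' E.
  have H2 := H u' r' u r Hu' Hr' Hu Hr su' sr' su sr (esym E).
  split; apply: (@eq_from_nth _ 0); rewrite ?su ?sr // => i ni;
    by have := H1 i ni; have := H2 i ni; lia.
move=> Hu Hr Hu' Hr' su sr su' sr' E i ni; split.
  have [] := Hu i; first by rewrite su.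
  rewrite su => ub _; have dn : n - i.+1 < n by lia.
  have zn : n - i.+1 - nth 0 u i < n by lia.
  have := congr1 (fun R : rel 'I_n => R (Ordinal zn) (Ordinal dn)) E.
  rewrite /reach_rel -!val_eqE /=.
  have -> : n - (n - i.+1).+1 = i by lia.
  lia.
have [] := Hr i; first by rewrite sr.
rewrite sr => rb _.
have := congr1 (fun R : rel 'I_n => R (Ordinal rb) (Ordinal ni)) E.
rewrite /reach_rel -!val_eqE /=; lia.
Qed.

Definition reach_graph n (p : seq nat * seq nat) : {set 'I_n * 'I_n} :=
  [set c | @reach_rel n p.1 p.2 c.1 c.2].

Lemma graph_rel_reach n p : graph_rel (reach_graph n p) = @reach_rel n p.1 p.2.
Proof. by apply/funext => a; apply/funext => b; rewrite /graph_rel inE. Qed.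

Lemma card_infinitely_modern n :
  #|[set P : {set 'I_n * 'I_n} | `[< infinitely_modern (graph_rel P) >]]|
    = ballot n 1.
Proof.
rewrite -size_tree_level -(size_map (reach_graph n)) cardE.
apply: perm_size; apply: uniq_perm; first exact: enum_uniq.
  rewrite map_inj_in_uniq ?uniq_tree_level // => -[u r] [u' r'].
  move=> /mem_tree_level[/= su sr Hu Hr _].
  move=> /mem_tree_level[/= su' sr' Hu' Hr' _].
  move=> /(congr1 (@graph_rel n)); rewrite !graph_rel_reach /=.
  by case/reach_rel_inj => // -> ->.
move=> P; rewrite mem_enum inE; apply/asboolP/mapP => [HP|[[u r]]].
  have [u [r [Hu Hr su sr E]]] := reach_of_interval_poset HP.1.
  exists (u, r).
    apply/mem_tree_level; split=> //=.
    by apply/infinitely_modern_reach => //; rewrite -E.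
  apply/setP => -[a b]; rewrite inE /= -E //.
move=> /mem_tree_level[/= su sr Hu Hr Hc] ->.
by rewrite graph_rel_reach; apply/infinitely_modern_reach.
Qed.

Local Open Scope ring_scope.

Theorem theorem5p7 (n : nat) :
  #|[set P : {set 'I_n * 'I_n} | `[< infinitely_modern (graph_rel P) >]]|%:R
    = 1 / (2 * n + 1)%N%:R * 'C(3 * n, n)%:R :> rat.
Proof.
rewrite card_infinitely_modern -ballot_ternary GRing.natrM GRing.div1r.
rewrite GRing.mulKf //.
by rewrite Num.Theory.pnatr_eq0 addn1.
Qed.
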